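(* Let $0\le\mu<Q$ and let $P(q)$ be a real-valued integrable splitting kernel, not necessarily of definite sign, decomposed as $P(q)=P^+(q)-P^-(q)$, where $P^\pm(q)=\pm P(q)$ if $P(q)\gtrless 0$ and $P^\pm(q)=0$ otherwise. Then the algorithm for splitting kernels of indefinite sign described in the context, run at fixed starting scale $Q$ until it returns a value $q$ with weight $+1$ or $-1$, and with the returned values counted with these weights, generates the (signed) density $$ {\rm d}S_P(\mu,q|Q)\times\Delta^2_{P^-}(\mu|Q), $$ where $$ \frac{{\rm d}S_P(\mu,q|Q)}{{\rm d}q}=\Delta_P(\mu|Q)\,\delta(q-\mu)+\theta(Q-q)\,\theta(q-\mu)\,P(q)\,\Delta_P(q|Q). $$
   Context: For an integrable function $f$ (of any sign) and scales $\mu\le q\le k\le Q$, the Sudakov form factor is $\Delta_f(q|k)=\exp\left(-\int_q^k f(t)\,{\rm d}t\right)$, and $\Delta_f^2(q|k)$ denotes its square. The density ${\rm d}S_f(\mu,q|k)$ is defined by $$ \frac{{\rm d}S_f(\mu,q|k)}{{\rm d}q}=\Delta_f(\mu|k)\,\delta(q-\mu)+\theta(k-q)\,\theta(q-\mu)\,f(q)\,\Delta_f(q|k), $$ where $\delta$ is the Dirac delta (the atom at $q=\mu$ counts with full mass $\Delta_f(\mu|k)$) and $\theta$ is the Heaviside step function. For $f\ge 0$ it is a probability density in $q$. Here $\mu$ is an infrared cutoff and $Q$ the starting scale. Algorithm for splitting kernels of indefinite sign. Loop over the following steps until a value is returned: 1. Draw $q_+$ from ${\rm d}S_{P^+}(\mu,q|Q)$.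 2. Draw $q_-$ from ${\rm d}S_{P^-}(\mu,q|Q)$. 3. Set $q=\max(q_+,q_-)$. 4. If $q=\mu$, return $\mu$ with weight $+1$. 5. Draw $t$ from ${\rm d}S_{2P^-}(\mu,t|q)$. 6. If $t=\mu$: return $q$ with weight $+1$ if $\max(q_+,q_-)=q_+$, and return $q$ with weight $-1$ otherwise. 7. If $t\neq\mu$, re-enter the loop at step 1. All draws are made independently of one another (the draw of $t$ depends on the earlier ones only through $q$).
   Formalization: The stated density is exact for each single pass of the loop; for the algorithm run until it returns a value, it is multiplied by 1/p, with p the probability that a pass returns, since the literal claim fails when p<1 (e.g. P=-c). *)

(* Defs.v *)
From HB Require Import structures.
From mathcomp Require Import all_boot all_order all_algebra.
From mathcomp Require Import all_classical all_reals all_analysis.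
Import Order.TTheory GRing.Theory Num.Theory.
Import numFieldNormedType.Exports.

Set Implicit Arguments.
Unset Strict Implicit.
Unset Printing Implicit Defensive.

Local Open Scope classical_set_scope.
Local Open Scope ring_scope.

Section Sudakov.
Context {R : realType}.

Definition sudakov (f : R -> R) (q k : R) : R :=
  expR (- Rintegral lebesgue_measure `[q, k] f).

(* The density dS_f(mu,q|k) as a set function: [sudakov_density f mu k A] is
   the integral of dS_f(mu,q|k) over q in A, with the Dirac delta evaluated as
   a full atom at mu. It takes negative values when f does. *)
Definition sudakov_density (f : R -> R) (mu k : R) (A : set R) : R :=
  sudakov f mu k * \1_A mu +
  Rintegral lebesgue_measure (A `&` `[mu, k]) (fun q => f q * sudakov f q k).

(* One pass through steps 1-7, as a function of its draws ((q_+, q_-), t).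
   [Some (q, w)]: the value q is returned with weight w.
   [None]: the loop is re-entered.
   The draw t is always supplied; it is ignored when step 4 returns. *)
Definition pass (mu : R) (d : R * R * R) : option (R * R) :=
  let: (qp, qm, t) := d in
  let q := Num.max qp qm in
  if q == mu then Some (mu, 1)
  else if t == mu then Some (q, if Num.max qp qm == qp then 1 else -1)
  else None.

(* The result of the first pass that returns; [None] if the loop never ends. *)
Definition loop (mu : R) (d : nat -> R * R * R) : option (R * R) :=
  match pselect (exists n, isSome (pass mu (d n))) with
  | left ends => pass mu (d (ex_minn ends))
  | right _ => None
  end.

(* Contribution to the bin A of a returned value, counted with its weight. *)
Definition weighted_count (A : set R) (r : option (R * R)) : R :=
  if r is Some (q, w) then w * \1_A q else 0.

End Sudakov.

Section Draws.
Context {R : realType} {d : measure_display} {T : measurableType d}.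
Variable Pr : probability T R.

Definition mutually_independent {d' : measure_display} {T' : measurableType d'}
    (X : nat -> T -> T') : Prop :=
  forall (s : seq nat) (B : nat -> set T'),
    uniq s -> (forall n, measurable (B n)) ->
    Pr (\bigcap_(n in [set` s]) (X n @^-1` B n)) =
    (\prod_(n <- s) fine (Pr (X n @^-1` B n)))%:E.

Definition pass_draws (qp qm t : nat -> T -> R) (n : nat) (w : T)
    : R * R * R :=
  (qp n w, qm n w, t n w).

(* qp n, qm n, t n are the draws q_+, q_-, t of the n-th pass. Passes that the
   loop never reaches also have draws; they do not affect its result. *)
Record algorithm_draws (P : R -> R) (mu Q : R) (qp qm t : nat -> {RV Pr >-> R})
    : Prop := {
  qplus_law : forall n (A : set R), measurable A ->
    Pr (qp n @^-1` A) = (sudakov_density P^\+ mu Q A)%:E ;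
  qminus_law : forall n (A : set R), measurable A ->
    Pr (qm n @^-1` A) = (sudakov_density P^\- mu Q A)%:E ;
  qplus_qminus_independent : forall n (A B : set R),
    measurable A -> measurable B ->
    Pr ((qp n @^-1` A) `&` (qm n @^-1` B)) =
    (Pr (qp n @^-1` A) * Pr (qm n @^-1` B))%E ;
  (* The conditional law of t given (q_+, q_-) is dS_{2P^-}(mu,.|q) with
     q = max(q_+, q_-). It is only imposed for q_+, q_- in [mu, Q], where they
     lie almost surely: P need not even be measurable outside [mu, Q]. *)
  t_conditional_law : forall n (D : set (R * R)) (C : set R),
    measurable D -> measurable C -> D `<=` `[mu, Q] `*` `[mu, Q] ->
    Pr ((fun w => (qp n w, qm n w)) @^-1` D `&` (t n @^-1` C)) =
    (\int[Pr]_(w in (fun w => (qp n w, qm n w)) @^-1` D)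
      (sudakov_density (fun x => 2 * P^\- x) mu
         (Num.max (qp n w) (qm n w)) C)%:E)%E ;
  passes_independent : mutually_independent (pass_draws qp qm t)
}.

(* The probability that a pass returns a value; all passes have the same law,
   so 1 / return_probability is the mean number of passes of the loop. *)
Definition return_probability (mu : R) (qp qm t : nat -> T -> R) : R :=
  fine (Pr [set w | isSome (pass mu (pass_draws qp qm t 0 w))]).

End Draws.

(* Main.v *)
Require Import Defs.
From HB Require Import structures.
From mathcomp Require Import all_boot all_order all_algebra.
From mathcomp Require Import all_classical all_reals all_analysis.
From mathcomp Require Import measurable_realfun ring lra.
Import Order.TTheory GRing.Theory Num.Theory.
Import numFieldNormedType.Exports.

(* Write F and G for P^+ and P^-. One pass returns a value in dq, q > mu, with
   weight +1 when q_+ = q, q_- <= q and t = mu. Since dS_G gives [mu, q] the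
   mass Delta_G(q|Q), this has probability F(q) W(q) dq, where
     W(q) = Delta_F(q|Q) Delta_G(q|Q) Delta_2G(mu|q);
   weight -1 has probability G(q) W(q) dq by symmetry. As
   W(q) = Delta_P(q|Q) Delta_G(mu|Q)^2, the difference (F - G) W is the density
   P(q) Delta_P(q|Q) Delta_G(mu|Q)^2, and the atom at mu matches likewise.
   Passes being independent and identically distributed, the first pass that
   returns has the law of one pass conditioned on returning. *)

Set Implicit Arguments.
Unset Strict Implicit.
Unset Printing Implicit Defensive.

Local Open Scope classical_set_scope.
Local Open Scope ring_scope.

(** The factor 2 in step 5 is what makes the result proportional to dS_P. Since P^+ = P + P^-, the
    two draws contribute Delta_P(q|Q) Delta_G(q|Q)^2; multiplying by Delta_2G(mu|q) =
    Delta_G(mu|q)^2 completes the surplus to Delta_G(mu|Q)^2, which no longer depends on q. The laws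
    of q_+ and q_- have a Lebesgue density only above mu, so the atom at mu is carried separately
    throughout. Because there is no atom above mu, the tie rule of step 6 does not affect any mass:
    the weak inequality for +1 and the strict one for -1 lead to the same formula. Conditioning on
    return divides the masses of both signs by the same number, so their difference is only
    rescaled. That number is at least Delta_F(mu|Q) Delta_G(mu|Q) > 0, the probability that both
    draws equal mu, and this already makes the loop end almost surely. *)

Lemma measurable_preimageT d d' (T : measurableType d) (T' : measurableType d')
    (f : T -> T') (A : set T') :
  measurable_fun setT f -> measurable A -> measurable (f @^-1` A).
Proof. by move=> mf mA; rewrite -[_ @^-1` _]setTI; exact: mf. Qed.

Lemma measurable_boolset d (T : measurableType d) (c : T -> bool) :
  measurable_fun setT c -> measurable [set z | c z].
Proof. by move=> mc; exact: (measurable_preimageT mc (A := [set true])). Qed.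

(** [nu] may have atoms outside [D], so it is first restricted to [D]. The restriction is dominated
    by [la], and its Radon-Nikodym derivative has the same integral as [h] over each measurable
    subset of [D], hence equals [h] almost everywhere there. *)
Lemma ge0_integral_density d (T : measurableType d) (R : realType)
    (nu : {finite_measure set T -> \bar R})
    (la : {sigma_finite_measure set T -> \bar R})
    (D : set T) (h f : T -> \bar R) :
  measurable D -> measurable_fun D h ->
  (forall B, measurable B -> B `<=` D -> nu B = (\int[la]_(x in B) h x)%E) ->
  measurable_fun D f -> (forall x, 0 <= f x)%E ->
  (\int[nu]_(x in D) f x = \int[la]_(x in D) (f x * h x))%E.
Proof.
move=> mD mh nuE mf f0.
have Doo : (nu D < +oo)%E by rewrite ltey_eq fin_num_measure.
pose nuD : {finite_measure set T -> \bar R} := mfrestr mD Doo.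
have nuDE B : nuD B = nu (B `&` D) by [].
have dom : nuD `<< la.
  move=> A nA B mB BA; rewrite nuDE nuE; [|exact: measurableI|exact: subIsetr].
  apply: null_set_integral => //; first exact: measurableI.
    by apply: measurable_funS mh => //; exact: subIsetr.
  by apply: nA => //; [exact: measurableI|exact: subset_trans (@subIsetl _ _ _) BA].
rewrite (@eq_measure_integral _ _ _ _ nuD)//; last first.
  by move=> A mA AD; rewrite -[LHS]/(nu A) -[RHS]/(nu (A `&` D)) setIidl.
rewrite -(Radon_Nikodym_SigmaFinite.change_of_variables dom)//.
have intr := Radon_Nikodym_SigmaFinite.f_integrable dom.
apply: ae_eq_integral => //.
- by apply: emeasurable_funM => //; apply/measurable_funTS/(measurable_int _ intr).
- exact: emeasurable_funM.
- apply: ae_eqe_mul2l; apply: integral_ae_eq => //.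
  + exact: integrableS intr.
  + move=> A AD mA; rewrite -Radon_Nikodym_SigmaFinite.f_integral// nuDE.
    by rewrite setIidl// nuE.
Qed.

(** * First success in a sequence of independent trials *)

Section first_return.
Context (R : realType) (d d' : measure_display)
  (T : measurableType d) (T' : measurableType d').
Variables (Pr : probability T R) (X : nat -> T -> T').

(** For [B] inside [N], this is the event that the first visit to [N] lands in [B]. Taking [B] equal
    to [N] gives termination; smaller [B] give the law of the returned value. *)
Definition first_hit_in (N B : set T') : set T :=
  [set w | exists n, B (X n w) /\ forall k, (k < n)%N -> ~ N (X k w)].

Lemma first_hit_in_at (N B : set T') n w :
  B `<=` N -> N (X n w) -> (forall k, (k < n)%N -> ~ N (X k w)) ->
  first_hit_in N B w <-> B (X n w).
Proof.
move=> BN Nn Nk; split=> [[m [Bm Nm]]|]; last by exists n.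
have [mn|nm|<-//] := ltngtP m n; first by have := Nk _ mn (BN _ Bm).
by have := Nm _ nm Nn.
Qed.

Hypothesis mX : forall n, measurable_fun setT (X n).
Variables (N B : set T').
Hypotheses (mN : measurable N) (mB : measurable B) (BN : B `<=` N).

(** The event that the first visit occurs at time [n], as a finite intersection over [iota 0 n.+1]
    so that [mutually_independent] applies to it directly. *)
Let hit n := \bigcap_(i in [set` iota 0 n.+1])
  (X i @^-1` (if (i < n)%N then ~` N else B)).

Let mpre n (A : set T') : measurable A -> measurable (X n @^-1` A).
Proof. exact: measurable_preimageT. Qed.

Let mhit n : measurable (hit n).
Proof.
apply: bigcap_measurable => [|i _]; first by exists 0%N.
by apply: mpre; case: ifP => // _; exact: measurableC.
Qed.

Let first_hit_inE : first_hit_in N B = \bigcup_n hit n.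
Proof.
apply/seteqP; split=> w.
  move=> [n [Bn Nk]]; exists n => // i; rewrite /mkset mem_iota add0n /= ltnS => ni.
  case: ifP => [/Nk//|]; move: ni; rewrite leq_eqVlt => /predU1P[->//|->//].
move=> [n _ h]; exists n; split.
  by have := h n; rewrite /mkset mem_iota add0n ltnSn ltnn; exact.
move=> k kn; have := h k.
by rewrite /mkset mem_iota add0n ltnS (ltnW kn) kn; exact.
Qed.

Lemma measurable_first_hit_in : measurable (first_hit_in N B).
Proof. by rewrite first_hit_inE; exact: bigcupT_measurable. Qed.

Hypothesis indep : mutually_independent Pr X.
Variables p q : R.
Hypotheses (p0 : 0 < p) (PN : forall n, Pr (X n @^-1` N) = p%:E)
  (PB : forall n, Pr (X n @^-1` B) = q%:E).

Let Phit n : Pr (hit n) = (geometric q (1 - p) n)%:E.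
Proof.
rewrite /hit (@indep (iota 0 n.+1) (fun i => if (i < n)%N then ~` N else B)).
- congr EFin; rewrite -addn1 iotaD big_cat/= add0n big_seq1 ltnn PB/=.
  rewrite mulrC; congr (_ * _).
  rewrite -[RHS]/((1 - p) ^+ n) -[in RHS](subn0 n) -prodr_const_nat.
  have -> : iota 0 n = index_iota 0 n by rewrite /index_iota subn0.
  apply: eq_big_nat => i /andP[_ ->].
  by rewrite preimage_setC probability_setC ?PN//; exact: mpre.
- exact: iota_uniq.
- by move=> i; case: ifP => // _; exact: measurableC.
Qed.

(** The events [hit n] are disjoint, since the earlier one demands a visit to [N] where the later
    one forbids it. Their probabilities [q * (1 - p) ^+ n] form a geometric series, which converges
    because [0 < p <= 1]. *)
Lemma probability_first_hit_in : Pr (first_hit_in N B) = (q / p)%:E.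
Proof.
have p1 : p <= 1 by rewrite -lee_fin -(PN 0) probability_le1//; exact: mpre.
rewrite first_hit_inE measure_bigcup//; last first.
  apply/trivIsetP => i j _ _; wlog ij : i j / (i < j)%N.
    move=> wl; rewrite neq_ltn => /orP[ij|ji]; first by apply: wl; rewrite ?neq_ltn ?ij.
    by rewrite setIC; apply: wl; rewrite ?neq_ltn ?ji.
  move=> _; apply/seteqP; split => // w [/(_ i) hi /(_ i) hj].
  move: hi hj; rewrite /mkset !mem_iota !add0n /= ltnSn ltnn ltnS (ltnW ij) ij.
  by move=> /(_ isT) /BN Nw /(_ isT).
rewrite (eq_eseriesr (fun n _ => Phit n)).
apply/cvg_lim => //.
rewrite (_ : (fun n => _) = EFin \o series (geometric q (1 - p))); last first.
  by apply/funext => n; rewrite /= /series /= -sumEFin; apply: eq_bigl => k; rewrite in_setT.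
apply: cvg_EFin; first exact: nearW.
have -> : q / p = q * (1 - (1 - p))^-1 by rewrite opprB addrC subrK.
apply: cvg_geometric_series.
by rewrite ger0_norm ?subr_ge0// ltrBlDr ltrDl.
Qed.

End first_return.

(** * Integrating f(q) Delta_f(q|b) without differentiating *)

Section real_analysis.
Context (R : realType).

(** Both [I] and [s - e * s] lie in the interval from [e * s * d] to [s * d], whose length
    [s * d * (1 - e)] is at most [d ^+ 2]. In the application [d] is the integral of f over [x, y],
    [e = expR (- d)], [s] is Delta_f(y|b) and [I] is the integral of f(q) Delta_f(q|b) over
    [x, y]. *)
Lemma normr_increment_le (s e d I : R) : 0 <= s -> s <= 1 -> 0 <= d ->
  0 <= e -> 1 - d <= e -> e * (1 + d) <= 1 ->
  e * s * d <= I -> I <= s * d -> `|I - (s - e * s)| <= d ^+ 2.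
Proof.
move=> s0 s1 d0 e0 e1 e2 Il Iu.
have sd2 : s * d * d <= d ^+ 2.
  by rewrite expr2 -mulrA ler_piMl// mulr_ge0.
have sde : s * d * (1 - e) <= s * d * d.
  by rewrite ler_wpM2l ?mulr_ge0// lerBlDr addrC -lerBlDr.
have su : s * (1 - e) <= s * d by rewrite ler_wpM2l// lerBlDr addrC -lerBlDr.
have sl : s * (e * d) <= s * (1 - e).
  by rewrite ler_wpM2l//; lra.
by rewrite ler_norml; apply/andP; split; lra.
Qed.

Implicit Types a b x y : R.

(** Choose points along which [G] rises by [C / n] at a time. The increments of [D] then sum to at
    most [n * (C / n) ^+ 2 = C ^+ 2 / n], which for large [n] falls below any positive
    [|D b - D a|]. The points need not be ordered, since the bound holds for every pair. *)
Lemma eq_endpoints_of_sqr_modulus (D G : R -> R) a b :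
  a <= b -> {within `[a, b], continuous G} -> G a <= G b ->
  (forall x y, x \in `[a, b] -> y \in `[a, b] ->
    `|D y - D x| <= (G y - G x) ^+ 2) ->
  D a = D b.
Proof.
move=> ab cG Gab DG.
have aab : a \in `[a, b] by rewrite in_itv/= lexx.
have bab : b \in `[a, b] by rewrite in_itv/= lexx andbT.
have DeqG x y : x \in `[a, b] -> y \in `[a, b] -> G x = G y -> D x = D y.
  move=> xab yab Gxy; apply/esym/eqP; rewrite -subr_eq0 -normr_le0.
  by rewrite (le_trans (DG _ _ xab yab))// Gxy subrr expr0n.
have [->//|/eqP Dab] := eqVneq (D a) (D b).
have e0 : 0 < `|D b - D a| by rewrite normr_gt0 subr_eq0 eq_sym; exact/eqP.
set C := G b - G a; have C0 : 0 <= C by rewrite subr_ge0.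
set n := Num.bound (C ^+ 2 / `|D b - D a|).
have Cn : C ^+ 2 < n%:R * `|D b - D a|.
  by rewrite -ltr_pdivrMr// archi_boundP// divr_ge0// ?sqr_ge0// ltW.
have n0 : 0 < n%:R :> R.
  rewrite ltr0n lt0n; apply/negP => /eqP n0.
  by move: Cn; rewrite n0 mul0r ltNge sqr_ge0.
have xP i : exists x, (i <= n)%N -> x \in `[a, b] /\ G x = G a + C * i%:R / n%:R.
  have [ni|_] := leqP i n; last by exists a.
  have [] := @IVT _ G a b (G a + C * i%:R / n%:R) ab cG.
    rewrite (min_idPl Gab) (max_idPr Gab) lerDl divr_ge0 ?mulr_ge0//=.
    rewrite -lerBrDl -/C ler_pdivrMr// ler_wpM2l// ler_nat//.
  by move=> x xab Gx; exists x.
have {xP}[x xP] := choice xP.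
(* The intermediate value theorem fixes only the value of [G], so [x 0] and [x n] may differ from
   [a] and [b]; equal values of [G] nevertheless force equal values of [D]. *)
have Dx0 : D a = D (x 0%N).
  by have [? Gx] := xP 0%N isT; apply: DeqG => //; rewrite Gx mulr0 mul0r addr0.
have Dxn : D b = D (x n).
  have [? Gx] := xP n (leqnn n); apply: DeqG => //.
  by rewrite Gx mulfK ?gt_eqF// addrC subrK.
suff : n%:R * `|D b - D a| <= C ^+ 2 by rewrite leNgt Cn.
rewrite Dx0 Dxn -(telescope_sumr (D \o x) (leq0n n)).
apply: (@le_trans _ _ (n%:R * \sum_(0 <= i < n) (C / n%:R) ^+ 2)).
  rewrite ler_wpM2l// (le_trans (ler_norm_sum _ _ _))// ler_sum_nat// => i /andP[_ ni].
  have [xi Gxi] := xP i (ltnW ni); have [xj Gxj] := xP i.+1 ni.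
  rewrite (le_trans (DG _ _ xi xj))// Gxi Gxj.
  by rewrite opprD addrACA subrr add0r -mulrBl -mulrBr -natr1 addrAC subrr add0r mulr1.
rewrite sumr_const_nat subn0 -[_ ^+ 2 *+ n]mulr_natl mulrA expr_div_n.
by rewrite [leLHS](_ : _ = C ^+ 2)//; field; rewrite gt_eqF.
Qed.

End real_analysis.

Section sudakov_calculus.
Context (R : realType).
Implicit Types (f : R -> R) (a b p q k x y : R).
Local Notation leb := (@lebesgue_measure R).

Lemma sudakov_gt0 f p q : 0 < sudakov f p q.
Proof. exact: expR_gt0. Qed.

Lemma sudakov_ge0 f p q : 0 <= sudakov f p q.
Proof. exact/ltW/sudakov_gt0. Qed.

Lemma sudakovxx f p : sudakov f p p = 1.
Proof. by rewrite /sudakov set_itv1 Rintegral_set1 oppr0 expR0. Qed.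

Lemma sudakov_le1 f p q : (forall x, 0 <= f x) -> sudakov f p q <= 1.
Proof. by move=> f0; rewrite -expR0 ler_expR lerNl oppr0 Rintegral_ge0. Qed.

Lemma sudakovM f p q k : p <= q -> q <= k ->
  leb.-integrable `[p, k] (EFin \o f) ->
  sudakov f p q * sudakov f q k = sudakov f p k.
Proof.
move=> pq qk fi; rewrite /sudakov -expRD -opprD; congr (expR (- _)).
apply/eqP; rewrite addrC eq_sym -subr_eq Rintegral_itvB ?bnd_simp//.
rewrite Rintegral_itv_obnd_cbnd//; apply: integrableS fi => //.
by apply: subset_itvr; rewrite bnd_simp.
Qed.

Lemma sudakovD (f g : R -> R) p q :
  leb.-integrable `[p, q] (EFin \o f) -> leb.-integrable `[p, q] (EFin \o g) ->
  sudakov f p q * sudakov g p q = sudakov (fun x => f x + g x) p q.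
Proof. by move=> ? ?; rewrite /sudakov -expRD -opprD RintegralD. Qed.

Lemma eq_sudakov f g p q : {in `[p, q], f =1 g} -> sudakov f p q = sudakov g p q.
Proof.
move=> fg; congr (expR (- _)); apply: eq_Rintegral => x.
by rewrite inE/= => /fg.
Qed.

Lemma measurable_sudakov_r f a b : a <= b ->
  leb.-integrable `[a, b] (EFin \o f) ->
  measurable_fun `[a, b] (fun x => sudakov f a x).
Proof.
move=> ab fi; apply: (measurableT_comp (@measurable_expR R)); apply: measurable_funN.
apply: subspace_continuous_measurable_fun => //.
exact: parameterized_integral_continuous.
Qed.

Lemma measurable_sudakov_l f a b : a <= b ->
  leb.-integrable `[a, b] (EFin \o f) ->
  measurable_fun `[a, b] (fun x => sudakov f x b).
Proof.
(* Delta(x|b) = Delta(a|b) / Delta(a|x) moves the variable to the upper endpoint, where the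
   primitive is continuous; the quotient is written through [expR] and [ln], both measurable. *)
move=> ab fi; apply: (@eq_measurable_fun _ _ _ _ _
    (fun x => sudakov f a b * expR (- ln (sudakov f a x)))).
  move=> x; rewrite inE/= in_itv/= => /andP[ax xb].
  by rewrite -(sudakovM ax xb)// expRN lnK ?posrE ?sudakov_gt0// mulrC
    mulKf// gt_eqF// sudakov_gt0.
apply: measurable_funM => //; apply: (measurableT_comp (@measurable_expR R)).
apply: measurable_funN; apply: (measurableT_comp (@measurable_ln R)).
exact: measurable_sudakov_r.
Qed.

Lemma integrableM_le1 (D : set R) f (h : R -> R) : measurable D ->
  leb.-integrable D (EFin \o f) -> measurable_fun D h ->
  (forall x, 0 <= h x <= 1) ->
  leb.-integrable D (EFin \o (fun x => f x * h x)).
Proof.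
move=> mD fi mh h01.
have := @integrableMl _ _ _ leb D mD _ _ fi mh; apply.
exists 1; split; first exact: num_real.
move=> M M1 x _ /=; have /andP[h0 h1] := h01 x.
by rewrite ger0_norm// (le_trans h1)// ltW.
Qed.

(* For integrable f the integrand need not have an antiderivative in the
   pointwise sense, so the fundamental theorem of calculus is replaced by
   comparing increments of both sides up to the square of the increment of
   the primitive of f. *)
Lemma Rintegral_sudakov f a b : a <= b -> (forall x, 0 <= f x) ->
  leb.-integrable `[a, b] (EFin \o f) ->
  Rintegral leb `[a, b] (fun q => f q * sudakov f q b) = 1 - sudakov f a b.
Proof.
move=> ab f0 fi.
have le1 x y : sudakov f x y <= 1 by exact: sudakov_le1.
have intf0 A : 0 <= Rintegral leb A f by exact: Rintegral_ge0.
have fM z c c' : c <= c' -> f z * c <= f z * c' by move=> cc'; rewrite ler_wpM2l.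
clear f0; pose F := fun q => f q * sudakov f q b.
have Fi : leb.-integrable `[a, b] (EFin \o F).
  apply: integrableM_le1 => //; first exact: measurable_sudakov_l.
  by move=> x; rewrite sudakov_ge0 le1.
pose G x := Rintegral leb `[a, x] f.
(* The claim is [D a = D b]: the left side is -Delta_f(a|b) and the right side is the full integral
   minus 1. *)
pose D x := Rintegral leb `[a, x] F - sudakov f x b.
have sub x y : a <= x -> y <= b -> `[x, y] `<=` `[a, b].
  by move=> ax yb; apply: subset_itv; rewrite bnd_simp.
have incr g x y : leb.-integrable `[a, b] (EFin \o g) ->
    a <= x -> x <= y -> y <= b ->
    Rintegral leb `[a, y] g - Rintegral leb `[a, x] g = Rintegral leb `[x, y] g.
  move=> gi ax xy yb; rewrite Rintegral_itvB ?bnd_simp//; last first.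
    by apply: integrableS gi => //; exact: sub.
  rewrite Rintegral_itv_obnd_cbnd//; apply: integrableS gi => //.
  by apply: subset_itv; rewrite bnd_simp.
have DG x y : a <= x -> x <= y -> y <= b -> `|D y - D x| <= (G y - G x) ^+ 2.
  move=> ax xy yb.
  have fxy : leb.-integrable `[x, y] (EFin \o f).
    by apply: integrableS fi => //; exact: sub.
  have Fxy : leb.-integrable `[x, y] (EFin \o F).
    by apply: integrableS Fi => //; exact: sub.
  have mono u v : a <= u -> u <= v -> v <= b -> sudakov f u b <= sudakov f v b.
    move=> au uv vb; rewrite -(sudakovM uv vb) ?ler_piMl ?sudakov_ge0 ?le1//.
    by apply: integrableS fi => //; exact: sub.
  have -> : D y - D x = Rintegral leb `[x, y] F - (sudakov f y b - sudakov f x b).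
    by rewrite -(incr F x y Fi ax xy yb) /D opprD opprK opprB addrACA [_ - sudakov _ _ _]addrC.
  rewrite (incr f x y fi ax xy yb); set d := Rintegral leb `[x, y] f.
  have d0 : 0 <= d by exact: intf0.
  have hE : sudakov f x b = expR (- d) * sudakov f y b.
    by rewrite -[LHS](sudakovM xy yb)//; apply: integrableS fi => //; exact: sub.
  (* As f is nonnegative, Delta_f(z|b) increases with z, so on [x, y] it lies between its values at
     the endpoints. *)
  have Fl : sudakov f x b * d <= Rintegral leb `[x, y] F.
    rewrite -RintegralZl//; apply: le_Rintegral => //.
      by apply: (@integrableZl _ _ _ leb _ _ (sudakov f x b) (EFin \o f)).
    move=> z /=; rewrite in_itv/= => /andP[xz zy]; rewrite mulrC; apply: fM.
    by apply: mono => //; exact: le_trans zy yb.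
  have Fu : Rintegral leb `[x, y] F <= sudakov f y b * d.
    rewrite -RintegralZl//; apply: le_Rintegral => //.
      by apply: (@integrableZl _ _ _ leb _ _ (sudakov f y b) (EFin \o f)).
    move=> z /=; rewrite in_itv/= => /andP[xz zy]; rewrite [leRHS]mulrC; apply: fM.
    by apply: mono => //; exact: le_trans ax xz.
  rewrite hE; apply: normr_increment_le => //; rewrite ?sudakov_ge0 ?le1 ?expR_ge0//.
  - exact: expR_ge1Dx.
  - rewrite -[leRHS]expR0 -(addNr d) expRD ler_wpM2l ?expR_ge0//.
    exact: expR_ge1Dx.
  - by rewrite -hE.
have : D a = D b.
  apply: (@eq_endpoints_of_sqr_modulus _ D G) => //.
  - exact: parameterized_integral_continuous.
  - by rewrite -subr_ge0 incr.
  - move=> x y; rewrite !in_itv/= => /andP[ax xb] /andP[ay yb].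
    have [xy|/ltW yx] := leP x y; first exact: DG.
    by rewrite distrC -[leRHS]sqrrN (opprB (G y) (G x)); exact: DG.
rewrite /D set_itv1 Rintegral_set1 sudakovxx sub0r => /eqP.
by rewrite eq_sym subr_eq addrC => /eqP.
Qed.

End sudakov_calculus.

(** * Masses of points and intervals under the Sudakov density *)

Section sudakov_density.
Context (R : realType) (f : R -> R) (mu Q : R).
Local Notation leb := (@lebesgue_measure R).
Hypotheses (f0 : forall x, 0 <= f x) (muQ : mu < Q).
Hypothesis fi : leb.-integrable `[mu, Q] (EFin \o f).

Lemma sudakov_density_set1 (h : R -> R) k x :
  sudakov_density h mu k [set x] = if x == mu then sudakov h mu k else 0.
Proof.
rewrite /sudakov_density /Rintegral (@integral_Sset1 _ _ _ x) ?addr0; last exact: subIsetl.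
rewrite indicE classical_sets.in_set1 eq_sym.
by case: eqP => _; rewrite ?mulr1 ?mulr0.
Qed.

Lemma integrable_sudakov_density :
  leb.-integrable `[mu, Q] (EFin \o (fun q => f q * sudakov f q Q)).
Proof.
apply: integrableM_le1 => //; first by apply: measurable_sudakov_l => //; exact: ltW.
by move=> x; rewrite sudakov_ge0 sudakov_le1.
Qed.

Lemma sudakov_density_oc (A : set R) : A `<=` `]mu, Q] ->
  sudakov_density f mu Q A =
  Rintegral leb A (fun q => f q * sudakov f q Q).
Proof.
move=> AQ; rewrite /sudakov_density indicE memNset; last first.
  by move=> /AQ /=; rewrite in_itv/= ltxx.
rewrite mulr0 add0r setIidl// => x /AQ; apply: subset_itv_oc_cc.
Qed.

(** By Delta(q|Q) = Delta(q|x) Delta(x|Q), the density on [mu, x] is Delta(x|Q) times the one with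
    starting scale x, whose total mass is 1 by [Rintegral_sudakov]. *)
Lemma sudakov_density_cc x : mu <= x -> x <= Q ->
  sudakov_density f mu Q `[mu, x] = sudakov f x Q.
Proof.
move=> mux xQ; have fix_ : leb.-integrable `[mu, x] (EFin \o f).
  by apply: integrableS fi => //; apply: subset_itvl; rewrite bnd_simp.
rewrite /sudakov_density indicE mem_set ?mulr1; last by rewrite /= in_itv/= lexx.
rewrite setIidl; last by apply: subset_itvl; rewrite bnd_simp.
have -> : Rintegral leb `[mu, x] (fun q => f q * sudakov f q Q) =
    Rintegral leb `[mu, x] (fun q => f q * sudakov f q x * sudakov f x Q).
  apply: eq_Rintegral => q; rewrite inE/= in_itv/= => /andP[muq qx].
  rewrite -mulrA (sudakovM qx xQ)//; apply: integrableS fi => //.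
  by apply: subset_itvr; rewrite bnd_simp.
rewrite RintegralZr//; last first.
  apply: integrableM_le1 => //; first exact: measurable_sudakov_l.
  by move=> y; rewrite sudakov_ge0 sudakov_le1.
by rewrite Rintegral_sudakov// mulrBl mul1r (sudakovM mux xQ)// addrC subrK.
Qed.

(** The interval is closed at [x] when [b] is true and open otherwise. Both cases agree because the
    only atom is at [mu < x]; they serve the weak and the strict comparison of the two draws. *)
Lemma sudakov_density_bnd (b : bool) x : mu < x -> x <= Q ->
  sudakov_density f mu Q [set` Interval (BLeft mu) (BSide (~~ b) x)] =
  sudakov f x Q.
Proof.
move=> mux xQ; rewrite -(sudakov_density_cc (ltW mux) xQ).
case: b => //=; rewrite /sudakov_density !indicE !mem_set; last 2 first.
- by rewrite /= in_itv/= lexx ?mux ?(ltW mux).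
- by rewrite /= in_itv/= lexx ?mux ?(ltW mux).
congr (_ + _); rewrite !setIidl; last 2 first.
- by apply: subset_itvl; rewrite bnd_simp.
- by apply: subset_itvl; rewrite bnd_simp.
rewrite Rintegral_itv_bndo_bndc//.
apply: integrableS integrable_sudakov_density => //.
by apply: subset_itvl; rewrite bnd_simp.
Qed.

End sudakov_density.

Lemma ge0_expectation_density (R : realType) d (T : measurableType d)
    (Pr : probability T R) (X : {RV Pr >-> R}) (D : set R) (h f : R -> \bar R) :
  measurable D -> measurable_fun D h ->
  (forall B, measurable B -> B `<=` D ->
     Pr (X @^-1` B) = (\int[lebesgue_measure]_(x in B) h x)%E) ->
  measurable_fun D f -> (forall x, 0 <= f x)%E ->
  (\int[Pr]_(w in X @^-1` D) f (X w) =
   \int[lebesgue_measure]_(x in D) (f x * h x))%E.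
Proof.
(* The codomain of X is read as the type carrying the Lebesgue measure, which
   has the same measurable sets as R but another display. *)
move=> mD mh PX mf f0; pose U : measurableType _ := measurableTypeR R.
have mX : measurable_fun setT (X : T -> U).
  by have := @measurable_funPT _ _ _ _ X.
pose Xm := isMeasurableFun.Build _ _ _ _ _ mX.
pose X' : {mfun T >-> U} := HB.pack (X : T -> U) Xm.
rewrite -(@ge0_integral_density _ U R (distribution Pr X') lebesgue_measure)//.
by rewrite ge0_integral_pushforward.
Qed.

(** * The larger of two independent draws *)

Section two_draws.
Context (R : realType) (d : measure_display) (T : measurableType d)
  (Pr : probability T R) (mu Q : R) (f g : R -> R) (X Y : {RV Pr >-> R}).
Local Notation leb := (@lebesgue_measure R).
Hypotheses (muQ : mu < Q) (f0 : forall x, 0 <= f x) (g0 : forall x, 0 <= g x).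
Hypothesis fi : leb.-integrable `[mu, Q] (EFin \o f).
Hypothesis gi : leb.-integrable `[mu, Q] (EFin \o g).
Hypothesis X_law : forall A, measurable A ->
  Pr (X @^-1` A) = (sudakov_density f mu Q A)%:E.
Hypothesis Y_law : forall A, measurable A ->
  Pr (Y @^-1` A) = (sudakov_density g mu Q A)%:E.
Hypothesis indep : forall A B, measurable A -> measurable B ->
  Pr ((X @^-1` A) `&` (Y @^-1` B)) = (Pr (X @^-1` A) * Pr (Y @^-1` B))%E.

(** By independence the joint law is a product, so Tonelli applies: for fixed [X = x] the condition
    on [Y] has probability Delta_g(x|Q), and [X] has density f(x) Delta_f(x|Q) on [A]. It is applied
    with [X] as q_+ and [b] true, then with [X] as q_- and [b] false. *)
Lemma integral_larger_draw (b : bool) (A : set R) (psi : R -> \bar R) :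
  measurable A -> A `<=` `]mu, Q] -> measurable_fun A psi ->
  (forall x, 0 <= psi x)%E ->
  (\int[Pr]_(w in [set w | [/\ A (X w), (mu <= Y w)%R & (Y w < X w ?<= if b)%R]])
     psi (X w) =
   \int[leb]_(x in A) (psi x * (sudakov g x Q * (f x * sudakov f x Q))%:E))%E.
Proof.
move=> mA AQ mpsi psi0.
pose E := [set z : R * R | mu <= z.2 /\ z.2 < z.1 ?<= if b].
have mE : measurable E.
  rewrite (_ : E = [set z | cst mu z <= z.2] `&`
                   [set z | if b then z.2 <= z.1 else z.2 < z.1]); last first.
    by apply/seteqP; split=> z; rewrite /E /= /Order.lteif; clear E; case: b => -[].
  apply: measurableI; apply: measurable_boolset; first exact: measurable_fun_ler.
  by clear E; case: b; [exact: measurable_fun_ler|exact: measurable_fun_ltr].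
(* [psi] is measurable only on [A], so it is extended by 0 before integrating over the whole
   plane. *)
pose phi (z : R * R) : \bar R := ((psi \_ A) z.1 * (\1_E z)%:E)%E.
have psiA0 x : (0 <= (psi \_ A) x)%E by rewrite patchE; case: ifP.
have mpsiA : measurable_fun setT (psi \_ A) by exact/(measurable_restrictT _ _).1.
have mphi : measurable_fun setT phi.
  apply: emeasurable_funM; first exact: measurableT_comp.
  by apply/measurable_EFinP; exact: measurable_indic.
have phi0 z : (0 <= phi z)%E by rewrite mule_ge0// lee_fin.
have mZ : measurable_fun setT (fun w => (X w, Y w)) by exact: measurable_fun_pair.
pose Zm := isMeasurableFun.Build _ _ _ _ _ mZ.
pose Z : {RV Pr >-> (R * R)%type} := HB.pack (fun w => (X w, Y w)) Zm.
transitivity (\int[Pr]_w (phi \o Z) w)%E.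
  rewrite integral_mkcond; apply: eq_integral => w _.
  rewrite /phi /= !patchE indicE.
  have -> : (w \in [set w | [/\ A (X w), (mu <= Y w)%R & (Y w < X w ?<= if b)%R]]) =
      (X w \in A) && ((X w, Y w) \in E).
    apply/idP/andP; rewrite !inE; first by case=> ? ? ?.
    by move=> [? [? ?]].
  by case: (X w \in A); case: (_ \in E); rewrite /= ?mule1 ?mule0 ?mul0e.
rewrite -ge0_integral_distribution//.
rewrite (@eq_measure_integral _ _ _ _ (distribution Pr X \x distribution Pr Y)%E); last first.
  move=> B mB _; apply/esym; apply: product_measure_unique => //.
rewrite fubini_tonelli1//.
transitivity (\int[distribution Pr X]_(x in A) (psi x * (sudakov g x Q)%:E))%E.
  rewrite [RHS]integral_mkcond; apply: eq_integral => x _.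
  have mEx : measurable (xsection E x) by exact: measurable_xsection.
  transitivity ((psi \_ A) x * \int[distribution Pr Y]_y (\1_(xsection E x) y)%:E)%E.
    rewrite -ge0_integralZl//.
      apply: eq_integral => y _; rewrite /phi /=.
      by rewrite !indicE mem_xsection.
    by apply/measurable_EFinP; exact: measurable_indic.
  rewrite integral_indic// setIT !patchE; case: ifPn => [|_]; last by rewrite mul0e.
  rewrite inE => /AQ /=; rewrite in_itv/= => /andP[mux xQ]; congr (_ * _)%E.
  rewrite -(sudakov_density_bnd g0 muQ gi b mux xQ) -Y_law//.
  congr (Pr (_ @^-1` _)); apply/seteqP; split=> y.
    rewrite /xsection /= inE /E /= in_itv/= => -[-> +].
    by rewrite /Order.lteif; case: (b).
  rewrite /xsection /= inE /E /= in_itv/= => /andP[-> +].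
  by rewrite /Order.lteif; case: (b).
have mfA : measurable_fun A (fun x => (f x * sudakov f x Q)%:E).
  have := measurable_int _ (integrable_sudakov_density f0 muQ fi).
  by apply: measurable_funS => // x /AQ; exact: subset_itv_oc_cc.
have mgA : measurable_fun A (fun x => (sudakov g x Q)%:E).
  apply/measurable_EFinP; have := measurable_sudakov_l (ltW muQ) gi.
  by apply: measurable_funS => // x /AQ; exact: subset_itv_oc_cc.
transitivity (\int[leb]_(x in A)
    (psi x * (sudakov g x Q)%:E * (f x * sudakov f x Q)%:E))%E.
  rewrite ge0_integral_pushforward//; last 2 first.
  - exact: emeasurable_funM.
  - by move=> x _; rewrite mule_ge0// lee_fin sudakov_ge0.
  apply: (@ge0_expectation_density _ _ _ _ _ _ (fun x => (f x * sudakov f x Q)%:E)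
    (fun x => psi x * (sudakov g x Q)%:E)%E) => //.
  - move=> B mB BA; rewrite X_law//.
    rewrite sudakov_density_oc//; last exact: subset_trans AQ.
    rewrite /Rintegral fineK//; apply: integrable_fin_num => //.
    apply: integrableS (integrable_sudakov_density f0 muQ fi) => //.
    by move=> x /BA /AQ; exact: subset_itv_oc_cc.
  - exact: emeasurable_funM.
  - by move=> x; rewrite mule_ge0// lee_fin sudakov_ge0.
by apply: eq_integral => x _; rewrite -muleA.
Qed.

End two_draws.

Section larger_draw_accepted.
Context (R : realType) (d : measure_display) (T : measurableType d)
  (Pr : probability T R) (mu Q : R) (f g : R -> R) (X Y : {RV Pr >-> R}).
Local Notation leb := (@lebesgue_measure R).
Hypotheses (muQ : mu < Q) (f0 : forall x, 0 <= f x) (g0 : forall x, 0 <= g x).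
Hypothesis fi : leb.-integrable `[mu, Q] (EFin \o f).
Hypothesis gi : leb.-integrable `[mu, Q] (EFin \o g).

Lemma integrable_draw_density (A : set R) (h : R -> R) :
  measurable A -> A `<=` `[mu, Q] -> measurable_fun A h ->
  (forall x, 0 <= h x <= 1) ->
  leb.-integrable A
    (EFin \o (fun x => f x * (sudakov f x Q * sudakov g x Q * h x))).
Proof.
move=> mA AQ mh h01; apply: integrableM_le1 => //.
- exact: integrableS fi.
- apply: measurable_funM => //; apply: measurable_funM.
    by apply: measurable_funS AQ _ => //; apply: measurable_sudakov_l => //; exact: ltW.
  by apply: measurable_funS AQ _ => //; apply: measurable_sudakov_l => //; exact: ltW.
- move=> x; have /andP[h0 h1] := h01 x.
  by rewrite !mulr_ge0 ?sudakov_ge0//= !mulr_ile1 ?mulr_ge0 ?sudakov_ge0 ?sudakov_le1.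
Qed.

Hypothesis X_law : forall A, measurable A ->
  Pr (X @^-1` A) = (sudakov_density f mu Q A)%:E.
Hypothesis Y_law : forall A, measurable A ->
  Pr (Y @^-1` A) = (sudakov_density g mu Q A)%:E.
Hypothesis indep : forall A B, measurable A -> measurable B ->
  Pr ((X @^-1` A) `&` (Y @^-1` B)) = (Pr (X @^-1` A) * Pr (Y @^-1` B))%E.

Lemma integral_larger_draw_Rintegral (b : bool) (A : set R) (h : R -> R) :
  measurable A -> A `<=` `]mu, Q] -> measurable_fun A h ->
  (forall x, 0 <= h x <= 1) ->
  (\int[Pr]_(w in [set w | [/\ A (X w), (mu <= Y w)%R & (Y w < X w ?<= if b)%R]])
     (h (X w))%:E)%E =
  (Rintegral leb A (fun x => f x * (sudakov f x Q * sudakov g x Q * h x)))%:E.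
Proof.
move=> mA AQ mh h01.
have AQc : A `<=` `[mu, Q] by move=> x /AQ; exact: subset_itv_oc_cc.
rewrite (@integral_larger_draw _ _ _ _ mu Q f g X Y _ _ _ _ _ _ _ _ b A (EFin \o h))//.
- rewrite /Rintegral fineK; last first.
    by apply: integrable_fin_num => //; exact: integrable_draw_density.
  by apply: eq_integral => x _; rewrite -EFinM /=; congr (_%:E); ring.
- exact/measurable_EFinP.
- by move=> x; rewrite lee_fin; case/andP: (h01 x).
Qed.

End larger_draw_accepted.

(** Used to restrict to the almost sure event that q_+ and q_- lie in [mu, Q], the region where the
    conditional law of [t] is prescribed. *)
Lemma probability_setI_full (R : realType) d (T : measurableType d)
    (Pr : probability T R) (S I : set T) :
  measurable S -> measurable I -> Pr I = 1%E -> Pr S = Pr (S `&` I).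
Proof.
move=> mS mI PI; have mSI := measurableI _ _ mS mI.
apply/eqP; rewrite eq_le; apply/andP; split; last first.
  by apply: le_measure; rewrite ?inE//; exact: subIsetl.
apply: (@le_trans _ _ (Pr ((S `&` I) `|` ~` I))).
  apply: le_measure; rewrite ?inE//; first by apply: measurableU => //; exact: measurableC.
  by move=> w Sw; have [Iw|] := pselect (I w); [left|right].
have nI : Pr (~` I) = 0%E by rewrite probability_setC// PI subee.
apply: le_trans; first by apply: measureU2 => //; exact: measurableC.
by rewrite [X in (_ + X)%E](_ : _ = 0%E)// adde0.
Qed.

(** * The outcomes of a pass as sets of draws *)

Section pass_sets.
Context (R : realType) (mu : R).

Definition returns_in (s : R) (A : set R) : set (R * R * R) :=
  [set z | exists2 q, pass mu z = Some (q, s) & A q].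

(** Step 6 tests equality with q_+, so a tie above [mu] returns weight +1: hence [y <= x] here and a
    strict inequality for weight -1. *)
Lemma returns_in1P A x y t : returns_in 1 A (x, y, t) <->
  (Num.max x y = mu /\ A mu) \/
  [/\ Num.max x y <> mu, t = mu, y <= x & A x].
Proof.
rewrite /returns_in /pass /=; have [->|/eqP xymu] := eqVneq (Num.max x y) mu.
  split=> [[q [<-] ?]|[[_ Amu]|[]//]]; [by left|by exists mu].
have [->|/eqP tmu] := eqVneq t mu; last by split=> [[]//|[[]//|[]//]].
move: xymu; have [yx|xy] := leP y x => xymu.
  by rewrite eqxx; split=> [[q [<-] Ax]|[[]//|[_ _ _ Ax]]]; [right|exists x].
rewrite gt_eqF//; split=> [[q [_ /eqP]]|[[]//|[]//]].
by rewrite lt_eqF// (lt_trans (ltrN10 _)) ?ltr01.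
Qed.

Lemma returns_inN1P A x y t : returns_in (- 1) A (x, y, t) <->
  [/\ Num.max x y <> mu, t = mu, x < y & A y].
Proof.
rewrite /returns_in /pass /=; have [->|/eqP xymu] := eqVneq (Num.max x y) mu.
  split=> [[q [_ /eqP]]|[]//].
  by rewrite gt_eqF// (lt_trans (ltrN10 _)) ?ltr01.
have [->|/eqP tmu] := eqVneq t mu; last by split=> [[]//|[]//].
move: xymu; have [yx|xy] := leP y x => xymu.
  rewrite eqxx; split=> [[q [_ /eqP]]|[]//].
  by rewrite gt_eqF// (lt_trans (ltrN10 _)) ?ltr01.
by rewrite gt_eqF//; split=> [[q [<-] Ay]|[_ _ _ Ay]]; [|exists y].
Qed.

Let mx := fun z : R * R * R => Num.max z.1.1 z.1.2.

Let mmx : measurable_fun setT mx.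
Proof. by apply: measurable_maxr; exact: measurableT_comp. Qed.

Lemma measurable_returns_in1 A : measurable A -> measurable (returns_in 1 A).
Proof.
move=> mA.
have -> : returns_in 1 A = (mx @^-1` ([set mu] `&` A)) `|`
    ((mx @^-1` (~` [set mu]) `&` (snd @^-1` [set mu])) `&`
     ([set z | z.1.2 <= z.1.1] `&` ((fst \o fst) @^-1` A))).
  apply/seteqP; split=> -[[x y] t].
    by case/returns_in1P => [[e Amu]|[]]; [left; rewrite /mx/= e|right].
  move=> h; apply/returns_in1P; case: h => [[/= e Amu]|[[? ?] [? ?]]].
    by left; split=> //; rewrite -e.
  by right.
apply: measurableU; first by apply: measurable_preimageT => //; exact: measurableI.
apply: measurableI; apply: measurableI.
- by apply: measurable_preimageT => //; exact: measurableC.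
- exact: measurable_preimageT.
- by apply: measurable_boolset; apply: measurable_fun_ler; exact: measurableT_comp.
- by apply: measurable_preimageT => //; exact: measurableT_comp.
Qed.

Lemma measurable_returns_inN1 A : measurable A -> measurable (returns_in (- 1) A).
Proof.
move=> mA.
have -> : returns_in (- 1) A =
    (mx @^-1` (~` [set mu]) `&` (snd @^-1` [set mu])) `&`
     ([set z | z.1.1 < z.1.2] `&` ((snd \o fst) @^-1` A)).
  apply/seteqP; split=> -[[x y] t]; first by case/returns_inN1P.
  by move=> [[? ?] [? ?]]; exact/returns_inN1P.
apply: measurableI; apply: measurableI.
- by apply: measurable_preimageT => //; exact: measurableC.
- exact: measurable_preimageT.
- by apply: measurable_boolset; apply: measurable_fun_ltr; exact: measurableT_comp.
- by apply: measurable_preimageT => //; exact: measurableT_comp.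
Qed.

Lemma isSome_passE z :
  isSome (pass mu z) <-> (returns_in 1 setT `|` returns_in (- 1) setT) z.
Proof.
split; last by case=> -[q ->].
rewrite /returns_in /pass; case: z => -[x y] t /=.
case: eqP => _; first by left; exists mu.
by case: eqP => // _; case: eqP => _ _; [left|right]; exists (Num.max x y).
Qed.

Lemma weighted_countE A z : weighted_count A (pass mu z) =
  \1_(returns_in 1 A) z - \1_(returns_in (- 1) A) z.
Proof.
have N11 : (-1 : R) <> 1 by apply/eqP; rewrite lt_eqF// (lt_trans (ltrN10 _)) ?ltr01.
have E s : (z \in returns_in s A) =
    if pass mu z is Some (q, w) then (w == s) && (q \in A) else false.
  apply/idP/idP; rewrite inE /returns_in /=.
    by case=> q -> Aq; rewrite eqxx mem_set.
  by case: (pass mu z) => // -[q w] /andP[/eqP <-]; rewrite inE; exists q.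
rewrite !indicE !E /weighted_count; case zE: (pass mu z) => [[q w]|]; last by rewrite subrr.
have [w1|wN1] : w = 1 \/ w = - 1.
  have : isSome (pass mu z) by rewrite zE.
  by case/isSome_passE => -[q' +] _; rewrite zE => -[_ ->]; [left|right].
- by rewrite w1 eqxx eq_sym (introF eqP N11) subr0 mul1r indicE.
- by rewrite wN1 eqxx (introF eqP N11) sub0r mulN1r indicE.
Qed.

End pass_sets.

(** * The signed density produced by one pass *)

Section accepted_density.
Context (R : realType) (mu Q : R) (P : R -> R).
Local Notation leb := (@lebesgue_measure R).
Hypothesis muQ : mu < Q.
Hypothesis Pi : leb.-integrable `[mu, Q] (EFin \o P).

Let fi : leb.-integrable `[mu, Q] (EFin \o P^\+).
Proof. exact: integrable_funrpos. Qed.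

Let gi : leb.-integrable `[mu, Q] (EFin \o P^\-).
Proof. exact: integrable_funrneg. Qed.

(* The probability that step 5 draws t = mu when max(q_+, q_-) = x. *)
Definition veto (x : R) : R := sudakov (fun y => 2 * P^\- y) mu x.

Let g2i : leb.-integrable `[mu, Q] (EFin \o (fun y => 2 * P^\- y)).
Proof.
have := @integrableZl _ _ _ leb `[mu, Q]%classic _ 2 (EFin \o P^\-).
by apply.
Qed.

Lemma veto01 x : 0 <= veto x <= 1.
Proof. by rewrite sudakov_ge0 sudakov_le1// => y; rewrite mulr_ge0. Qed.

Lemma measurable_veto : measurable_fun `[mu, Q] veto.
Proof. by apply: measurable_sudakov_r => //; exact: ltW. Qed.

(** For [h] equal to [P^\+] or [P^\-], the probability that a pass returns a value above [mu] in [A]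
    with weight +1 or -1 respectively. *)
Definition accepted (A : set R) (h : R -> R) : R :=
  Rintegral leb (A `&` `]mu, Q])
    (fun x => h x * (sudakov P^\+ x Q * sudakov P^\- x Q * veto x)).

(** [P^\+] is the sum of [P] and [P^\-], so its factor splits off a second Delta_{P^-}(x|Q);
    [veto x] is the square of Delta_{P^-}(mu|x), and the two squares join at [x]. *)
Lemma draw_density_veto x : mu <= x -> x <= Q ->
  sudakov P^\+ x Q * sudakov P^\- x Q * veto x =
  sudakov P x Q * sudakov P^\- mu Q ^+ 2.
Proof.
move=> mux xQ.
have sub1 (h : R -> R) : leb.-integrable `[mu, Q] (EFin \o h) ->
    leb.-integrable `[x, Q] (EFin \o h).
  by apply: integrableS => //; apply: subset_itvr; rewrite bnd_simp.
have sub2 (h : R -> R) : leb.-integrable `[mu, Q] (EFin \o h) ->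
    leb.-integrable `[mu, x] (EFin \o h).
  by apply: integrableS => //; apply: subset_itvl; rewrite bnd_simp.
have -> : sudakov P^\+ x Q = sudakov P x Q * sudakov P^\- x Q.
  rewrite sudakovD; [|exact: sub1..]; apply: eq_sudakov => y _.
  by rewrite -[in P y](funrposBneg P) /= -[(_ - _) y]/(P^\+ y - P^\- y) subrK.
have -> : veto x = sudakov P^\- mu x * sudakov P^\- mu x.
  rewrite sudakovD; [|exact: sub2..]; apply: eq_sudakov => y _.
  by rewrite mulr_natl.
rewrite -(sudakovM mux xQ gi).
by move: (sudakov P x Q) (sudakov _ x Q) (sudakov _ mu x) => u v w; ring.
Qed.

Lemma integrable_accepted1 A : measurable A -> leb.-integrable (A `&` `]mu, Q])
  (EFin \o (fun x => P^\+ x * (sudakov P^\+ x Q * sudakov P^\- x Q * veto x))).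
Proof.
move=> mA; have AQ : A `&` `]mu, Q] `<=` `[mu, Q].
  by move=> x [_]; exact: subset_itv_oc_cc.
apply: (integrable_draw_density muQ _ _ fi gi _ AQ _ veto01) => //.
  exact: measurableI.
by apply: (measurable_funS _ AQ measurable_veto).
Qed.

Lemma integrable_acceptedN1 A : measurable A -> leb.-integrable (A `&` `]mu, Q])
  (EFin \o (fun x => P^\- x * (sudakov P^\+ x Q * sudakov P^\- x Q * veto x))).
Proof.
move=> mA; have AQ : A `&` `]mu, Q] `<=` `[mu, Q].
  by move=> x [_]; exact: subset_itv_oc_cc.
suff : leb.-integrable (A `&` `]mu, Q]) (EFin \o (fun x =>
    P^\- x * (sudakov P^\- x Q * sudakov P^\+ x Q * veto x))).
  apply: eq_integrable => [|x _ /=]; first exact: measurableI.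
  by move: (sudakov P^\- x Q) (sudakov P^\+ x Q) => u v; rewrite (mulrC u).
apply: (integrable_draw_density muQ _ _ gi fi _ AQ _ veto01) => //.
  exact: measurableI.
by apply: (measurable_funS _ AQ measurable_veto).
Qed.

Lemma acceptedB (A : set R) : measurable A ->
  sudakov P^\+ mu Q * sudakov P^\- mu Q * \1_A mu +
    accepted A P^\+ - accepted A P^\- =
  sudakov_density P mu Q A * sudakov P^\- mu Q ^+ 2.
Proof.
move=> mA; have mD : measurable (A `&` `]mu, Q]) by exact: measurableI.
set c := sudakov P^\- mu Q ^+ 2.
have c0 : c != 0 by rewrite expf_neq0// gt_eqF// sudakov_gt0.
pose F x := P^\+ x * (sudakov P^\+ x Q * sudakov P^\- x Q * veto x) -
            P^\- x * (sudakov P^\+ x Q * sudakov P^\- x Q * veto x).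
have Fi : leb.-integrable (A `&` `]mu, Q]) (EFin \o F).
  have Fi := integrableB _ (integrable_accepted1 mA) (integrable_acceptedN1 mA).
  by apply: eq_integrable (Fi mD) => // x _; rewrite /F /= EFinB.
(* Written as a multiple of [F], the target density inherits measurability from an integrand already
   known to be integrable. *)
have FE x : x \in A `&` `]mu, Q] -> P x * sudakov P x Q = F x * c^-1.
  rewrite inE => -[_ /=]; rewrite in_itv/= => /andP[/ltW mux xQ].
  rewrite /F -mulrBl draw_density_veto// -/c mulrA mulfK//.
  by rewrite -{1}(funrposBneg P).
have dE : Rintegral leb (A `&` `[mu, Q]) (fun q => P q * sudakov P q Q) =
    Rintegral leb (A `&` `]mu, Q]) F * c^-1.
  transitivity (Rintegral leb (A `&` `]mu, Q]) (fun q => P q * sudakov P q Q));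
    last by rewrite -RintegralZr//; apply: eq_Rintegral => x /FE.
  have AD : A `&` `]mu, Q] = (A `&` `[mu, Q]) `\ mu by rewrite -setIDA setDitv1l.
  rewrite /Rintegral AD integral_setD1// -AD//.
  apply: (@eq_measurable_fun _ _ _ _ _ (fun x => (F x * c^-1)%:E)).
    by move=> x /FE ->.
  apply/measurable_EFinP; apply: measurable_funM => //.
  by apply/measurable_EFinP; exact: (measurable_int _ Fi).
rewrite /accepted -addrA -RintegralB//; last 2 first.
- exact: integrable_accepted1.
- exact: integrable_acceptedN1.
rewrite /sudakov_density dE mulrDl mulfVK//; congr (_ + _).
(* The atom is the same identity at [x = mu], where the veto factor is 1. *)
have := draw_density_veto (lexx mu) (ltW muQ).
by rewrite /veto sudakovxx mulr1 -/c => ->; ring.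
Qed.

End accepted_density.

(** * Probabilities of the two weights in one pass *)

Section algorithm.
Context (R : realType) (mu Q : R) (P : R -> R) (d : measure_display)
  (T : measurableType d) (Pr : probability T R) (qp qm t : nat -> {RV Pr >-> R}).
Local Notation leb := (@lebesgue_measure R).
Hypotheses (muQ : mu < Q) (Pi : leb.-integrable `[mu, Q] (EFin \o P)).
Hypothesis draws : algorithm_draws P mu Q qp qm t.

Let f0 x : 0 <= P^\+ x. Proof. exact: funrpos_ge0. Qed.
Let g0 x : 0 <= P^\- x. Proof. exact: funrneg_ge0. Qed.

Let fi : leb.-integrable `[mu, Q] (EFin \o P^\+).
Proof. exact: integrable_funrpos. Qed.

Let gi : leb.-integrable `[mu, Q] (EFin \o P^\-).
Proof. exact: integrable_funrneg. Qed.

Let mqp n A : measurable A -> measurable (qp n @^-1` A).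
Proof. exact: measurable_preimageT. Qed.

Let mqm n A : measurable A -> measurable (qm n @^-1` A).
Proof. exact: measurable_preimageT. Qed.

Let mt n A : measurable A -> measurable (t n @^-1` A).
Proof. exact: measurable_preimageT. Qed.

Lemma measurable_pass_draws n : measurable_fun setT (pass_draws qp qm t n).
Proof. by apply: measurable_fun_pair => //; exact: measurable_fun_pair. Qed.

Let mpass n B : measurable B -> measurable (pass_draws qp qm t n @^-1` B).
Proof. exact: (measurable_preimageT (measurable_pass_draws n)). Qed.

Let in_range n : set T := (qp n @^-1` `[mu, Q]) `&` (qm n @^-1` `[mu, Q]).

Let min_range n : measurable (in_range n).
Proof. by apply: measurableI; [exact: mqp|exact: mqm]. Qed.

Let Pin_range n : Pr (in_range n) = 1%E.
Proof.
rewrite (qplus_qminus_independent draws)// (qplus_law draws)// (qminus_law draws)//.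
rewrite !sudakov_density_cc// ?ltW//; [by rewrite !sudakovxx mul1e|..].
Qed.

(** Given the other draws, [t] equals [mu] with probability [veto] of the larger one. [D] presents
    [W] through the pair of draws inside the square where the conditional law is available. *)
Let veto_law v n (X : {RV Pr >-> R}) (D : set (R * R)) (W : set T) :
  measurable D -> D `<=` `[mu, Q] `*` `[mu, Q] ->
  W = (fun w => (qp n w, qm n w)) @^-1` D ->
  (forall w, W w -> Num.max (qp n w) (qm n w) = X w) ->
  (\int[Pr]_(w in W) (veto mu P (X w))%:E)%E = v ->
  Pr (W `&` (t n @^-1` [set mu])) = v.
Proof.
move=> mD DQ WE WX <-; rewrite {1}WE (t_conditional_law draws)// -WE.
apply: eq_integral => w; rewrite inE => /WX ->.
by rewrite sudakov_density_set1 eqxx.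
Qed.

Let mA' (A : set R) : measurable A -> measurable (A `&` `]mu, Q]).
Proof. by move=> mA; exact: measurableI. Qed.

Let mvetoA (A : set R) : measurable_fun (A `&` `]mu, Q]) (veto mu P).
Proof.
have AQ : A `&` `]mu, Q] `<=` `[mu, Q] by move=> x [_]; exact: subset_itv_oc_cc.
by apply: (measurable_funS _ AQ (measurable_veto muQ Pi)).
Qed.

Let plus_wins n A : measurable A ->
  Pr ([set w | [/\ (A `&` `]mu, Q]) (qp n w), mu <= qm n w &
                   qm n w < qp n w ?<= if true]] `&` (t n @^-1` [set mu])) =
  (accepted mu Q P A P^\+)%:E.
Proof.
move=> mA; pose D := [set z : R * R | (A `&` `]mu, Q]) z.1] `&`
  ([set z : R * R | cst mu z <= z.2] `&` [set z : R * R | z.2 <= z.1]).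
apply: (@veto_law _ n (qp n) D).
- apply: measurableI.
    by rewrite -[X in measurable X]setTI; apply: measurable_fst => //; exact: mA'.
  by apply: measurableI; apply: measurable_boolset; exact: measurable_fun_ler.
- move=> [x y] [[_ /=]]; rewrite !in_itv/= => /andP[mux xQ] [muy yx].
  by split; rewrite ?(ltW mux) ?muy ?xQ//= (le_trans yx).
- by apply/seteqP; split=> w; [case=> ? ? ?; split|case=> ? []].
- by move=> w [_ _ h]; apply/max_idPl.
apply: integral_larger_draw_Rintegral => //.
- exact: qplus_law draws n.
- exact: qminus_law draws n.
- exact: qplus_qminus_independent draws n.
- exact: mA'.
- exact: veto01.
Qed.

(** Mirror image of [plus_wins]: the draws exchange roles and the comparison becomes strict. *)
Let minus_wins n A : measurable A ->
  Pr ([set w | [/\ (A `&` `]mu, Q]) (qm n w), mu <= qp n w &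
                   qp n w < qm n w ?<= if false]] `&` (t n @^-1` [set mu])) =
  (accepted mu Q P A P^\-)%:E.
Proof.
move=> mA; pose D := [set z : R * R | (A `&` `]mu, Q]) z.2] `&`
  ([set z : R * R | cst mu z <= z.1] `&` [set z : R * R | z.1 < z.2]).
apply: (@veto_law _ n (qm n) D).
- apply: measurableI.
    by rewrite -[X in measurable X]setTI; apply: measurable_snd => //; exact: mA'.
  by apply: measurableI; apply: measurable_boolset; [exact: measurable_fun_ler|exact: measurable_fun_ltr].
- move=> [x y] [[_ /=]]; rewrite !in_itv/= => /andP[muy yQ] [mux xy].
  by split; rewrite ?(ltW muy) ?mux ?yQ//= (le_trans (ltW xy)).
- by apply/seteqP; split=> w; [case=> ? ? ?; split|case=> ? []].
- by move=> w [_ _ h]; apply/max_idPr/ltW.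
have -> : accepted mu Q P A P^\- = Rintegral leb (A `&` `]mu, Q]) (fun x =>
    P^\- x * (sudakov P^\- x Q * sudakov P^\+ x Q * veto mu P x)).
  apply: eq_Rintegral => x _.
  by move: (sudakov P^\- x Q) (sudakov P^\+ x Q) => u v; rewrite (mulrC u).
apply: integral_larger_draw_Rintegral => //.
- exact: qminus_law draws n.
- exact: qplus_law draws n.
- move=> B C mB mC; rewrite setIC (qplus_qminus_independent draws)//.
  exact: muleC.
- exact: mA'.
- exact: veto01.
Qed.

Lemma pass_law1 n A : measurable A ->
  Pr (pass_draws qp qm t n @^-1` returns_in mu 1 A) =
  (sudakov P^\+ mu Q * sudakov P^\- mu Q * \1_A mu +
   accepted mu Q P A P^\+)%:E.
Proof.
move=> mA; rewrite (@probability_setI_full _ _ _ _ _ (in_range n))//; last first.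
  by apply: mpass; exact: measurable_returns_in1.
(* Inside [mu, Q] the maximum is [mu] only if both draws are, so step 4 is the event [W0], whose
   probability is the product of the two atoms. The constant set over [A mu] is everything or empty
   and encodes the indicator. *)
pose W0 := ((qp n @^-1` [set mu]) `&` (qm n @^-1` [set mu])) `&` [set _ : T | A mu].
pose W1 := [set w | [/\ (A `&` `]mu, Q]) (qp n w), mu <= qm n w &
                   qm n w < qp n w ?<= if true]] `&` (t n @^-1` [set mu]).
have -> : pass_draws qp qm t n @^-1` returns_in mu 1 A `&` in_range n = W0 `|` W1.
  apply/seteqP; split=> w.
    move=> [/returns_in1P h [/= /[!in_itv]/= /andP[mux xQ] /andP[muy yQ]]].
    case: h => [[mxy Amu]|[mxy tmu yx Ax]].
      left; split => //; split => /=; apply/eqP; rewrite eq_le ?mux ?muy andbT.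
        by rewrite -mxy le_max lexx.
      by rewrite -mxy le_max lexx orbT.
    right; split => //; split => //; split => //=; rewrite in_itv/= xQ andbT.
    by rewrite lt_neqAle mux andbT eq_sym; apply/eqP; rewrite -{1}(max_idPl yx).
  case=> [[[/= x0 y0] Amu]|[[[Ax /=]]]].
    split; last by rewrite /in_range /= x0 y0 !in_itv/= lexx ltW.
    by apply/returns_in1P; left; rewrite x0 y0 maxxx.
  rewrite in_itv/= => /andP[mux xQ] muy yx tmu; split.
    apply/returns_in1P; right; split=> //; rewrite (max_idPl yx).
    by apply/eqP; rewrite gt_eqF.
  by rewrite /in_range /= !in_itv/= (ltW mux) xQ muy (le_trans yx).
have mW0 : measurable W0.
  apply: measurableI; first by apply: measurableI; [exact: mqp|exact: mqm].
  have [Amu|nAmu] := pselect (A mu).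
    by rewrite (_ : [set _ : T | A mu] = setT)//; apply/seteqP; split.
  by rewrite (_ : [set _ : T | A mu] = set0)//; apply/seteqP; split.
have mW1 : measurable W1.
  rewrite /W1 (_ : [set w | _] = ((qp n @^-1` (A `&` `]mu, Q])) `&`
      ([set w | cst mu w <= qm n w] `&` [set w | qm n w <= qp n w]))).
    apply: measurableI; last exact: mt.
    apply: measurableI; first by apply: mqp; exact: mA'.
    by apply: measurableI; apply: measurable_boolset; exact: measurable_fun_ler.
  by apply/seteqP; split=> w; [case=> ? ? ?|case=> ? [? ?]].
rewrite measureU//; last first.
  apply/seteqP; split => // w [[[/= x0 _] _] [[[_ /=]]]].
  by rewrite x0 in_itv/= ltxx.
rewrite EFinD; congr (_ + _)%E; last exact: plus_wins.
have [Amu|nAmu] := pselect (A mu).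
  rewrite indicE mem_set// mulr1 /W0 (_ : [set _ : T | A mu] = setT); last first.
    by apply/seteqP; split.
  have m1 : measurable ([set mu] : set R) by exact: measurable_set1.
  rewrite setIT; apply: etrans (qplus_qminus_independent draws n m1 m1) _.
  by rewrite (qplus_law draws n m1) (qminus_law draws n m1) !sudakov_density_set1 eqxx.
rewrite indicE memNset// mulr0 /W0 (_ : [set _ : T | A mu] = set0); last first.
  by apply/seteqP; split.
by rewrite setI0 measure0.
Qed.

Lemma pass_lawN1 n A : measurable A ->
  Pr (pass_draws qp qm t n @^-1` returns_in mu (- 1) A) =
  (accepted mu Q P A P^\-)%:E.
Proof.
move=> mA; rewrite (@probability_setI_full _ _ _ _ _ (in_range n))//; last first.
  by apply: mpass; exact: measurable_returns_inN1.
rewrite -(minus_wins n mA); congr (Pr _).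
apply/seteqP; split=> w.
  move=> [/returns_inN1P [_ tmu xy Ay] [/= /[!in_itv]/= /andP[mux xQ] /andP[muy yQ]]].
  split => //; split => //; split => //=; rewrite yQ andbT.
  exact: le_lt_trans xy.
case=> [[[Ay /=]]]; rewrite in_itv/= => /andP[muy yQ] mux xy tmu; split.
  apply/returns_inN1P; split=> //; rewrite (max_idPr (ltW xy)).
  by apply/eqP; rewrite gt_eqF.
by rewrite /in_range /= !in_itv/= (ltW muy) yQ mux (le_trans (ltW xy)).
Qed.

End algorithm.

Lemma expectation_indicB (R : realType) d (T : measurableType d)
    (Pr : probability T R) (S S' : set T) : measurable S -> measurable S' ->
  ('E_Pr[fun w => (\1_S w - \1_S' w)%R] = Pr S - Pr S')%E.
Proof.
move=> mS mS'; rewrite unlock integralB_EFin//; last 2 first.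
- exact: integrable_indic.
- exact: integrable_indic.
by rewrite !integral_indic// !setIT.
Qed.

(** * The loop as a first visit to the returning draws *)

Section returning.
Context (R : realType) (mu : R).

Definition returning : set (R * R * R) :=
  returns_in mu 1 setT `|` returns_in mu (- 1) setT.

Lemma returns_in_returning1 A : returns_in mu 1 A `<=` returning.
Proof. by move=> z [q zq _]; left; exists q. Qed.

Lemma returns_in_returningN1 A : returns_in mu (- 1) A `<=` returning.
Proof. by move=> z [q zq _]; right; exists q. Qed.

End returning.

Section loop_events.
Context (R : realType) (mu : R) (d : measure_display) (T : measurableType d)
  (X : nat -> T -> R * R * R).

Lemma isSome_loopE w : isSome (loop mu (fun n => X n w)) <->
  first_hit_in X (returning mu) (returning mu) w.
Proof.
rewrite /loop; case: pselect => [ends|nends].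
  case: ex_minnP => n sn nmin; split=> // _.
  exists n; split=> [|k kn /isSome_passE /nmin]; first exact/isSome_passE.
  by rewrite leqNgt kn.
by split=> // -[n [/isSome_passE sn _]]; exfalso; apply: nends; exists n.
Qed.

(** [ex_minn] picks the first returning pass, so the loop inherits the split of a single pass by
    weight. If no pass returns, both indicators vanish, in agreement with the count 0 of [None]. *)
Lemma weighted_count_loopE A w : weighted_count A (loop mu (fun n => X n w)) =
  \1_(first_hit_in X (returning mu) (returns_in mu 1 A)) w -
  \1_(first_hit_in X (returning mu) (returns_in mu (- 1) A)) w.
Proof.
rewrite /loop; case: pselect => [ends|nends]; last first.
  have nhit B : B `<=` returning mu -> ~ first_hit_in X (returning mu) B w.
    by move=> BN [n [/BN /isSome_passE sn _]]; apply: nends; exists n.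
  rewrite !indicE !memNset ?subrr//; apply: nhit.
    exact: returns_in_returningN1.
  exact: returns_in_returning1.
case: ex_minnP => n sn nmin; rewrite weighted_countE !indicE.
have hitE B : B `<=` returning mu ->
    (w \in first_hit_in X (returning mu) B) = (X n w \in B).
  move=> BN.
  have hitP : first_hit_in X (returning mu) B w <-> B (X n w).
    apply: first_hit_in_at => //; first exact/isSome_passE.
    by move=> k kn /isSome_passE /nmin; rewrite leqNgt kn.
  by apply/idP/idP; rewrite !inE => /hitP.
rewrite !hitE//; [exact: returns_in_returningN1|exact: returns_in_returning1].
Qed.

End loop_events.

Unset Implicit Arguments.

Theorem mainTheorem3 (R : realType) (mu Q : R) (P : R -> R)
    (d : measure_display) (T : measurableType d) (Pr : probability T R)
    (qp qm t : nat -> {RV Pr >-> R}) :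
  0 <= mu -> mu < Q ->
  lebesgue_measure.-integrable `[mu, Q] (EFin \o P) ->
  algorithm_draws P mu Q qp qm t ->
  [/\ (* the loop terminates almost surely *)
      Pr [set w | isSome (loop mu (fun n => pass_draws qp qm t n w))] = 1%E,
      0 < return_probability Pr mu qp qm t,
      (* weighted returned values per pass *)
      (forall (n : nat) (A : set R), measurable A ->
        ('E_Pr[fun w => weighted_count A (pass mu (pass_draws qp qm t n w))] =
         (sudakov_density P mu Q A * sudakov P^\- mu Q ^+ 2)%:E)%E) &
      (* weighted returned values per run of the loop *)
      (forall A : set R, measurable A ->
        ('E_Pr[fun w =>
                 weighted_count A (loop mu (fun n => pass_draws qp qm t n w))] =
         ((return_probability Pr mu qp qm t)^-1 *
          (sudakov_density P mu Q A * sudakov P^\- mu Q ^+ 2))%:E)%E)].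
Proof.
move=> mu0 muQ Pi draws.
set D := pass_draws qp qm t.
have mD n : measurable_fun setT (D n) by exact: measurable_pass_draws.
have mpre n B : measurable B -> measurable (D n @^-1` B).
  exact: measurable_preimageT.
have mN : measurable (returning mu).
  by apply: measurableU; [exact: measurable_returns_in1|exact: measurable_returns_inN1].
set s := sudakov P^\+ mu Q * sudakov P^\- mu Q.
have law1 n A : measurable A -> Pr (D n @^-1` returns_in mu 1 A) =
    (s * \1_A mu + accepted mu Q P A P^\+)%:E.
  exact: pass_law1.
have lawN1 n A : measurable A -> Pr (D n @^-1` returns_in mu (- 1) A) =
    (accepted mu Q P A P^\-)%:E.
  exact: pass_lawN1.
(* The masses of the two weights are added here, not subtracted, since either weight ends the
   loop. *)
pose p := s * \1_setT mu + accepted mu Q P setT P^\+ + accepted mu Q P setT P^\-.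
have lawN n : Pr (D n @^-1` returning mu) = p%:E.
  have mB1 := mpre n _ (measurable_returns_in1 mu measurableT).
  have mBN1 := mpre n _ (measurable_returns_inN1 mu measurableT).
  rewrite preimage_setU measureU//.
    exact: (congr2 (@adde R) (law1 n _ measurableT) (lawN1 n _ measurableT)).
  apply/seteqP; split=> // w [[q zq _] [q' zq' _]].
  have : (1 : R) = - 1 by move: zq; rewrite zq' => -[_ ->].
  by move/eqP; rewrite gt_eqF// (lt_trans (ltrN10 _)) ?ltr01.
(* The atom at [mu] suffices: [s] is a product of exponentials and the other terms are
   nonnegative. *)
have p0 : 0 < p.
  have acc0 (h : R -> R) : (forall x, 0 <= h x) -> 0 <= accepted mu Q P setT h.
    by move=> h0; apply: Rintegral_ge0 => x _; rewrite !mulr_ge0 ?sudakov_ge0.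
  rewrite /p indicT mulr1 -addrA ltr_wpDr ?mulr_gt0 ?sudakov_gt0// addr_ge0// acc0//.
have rp : return_probability Pr mu qp qm t = p.
  rewrite /return_probability (_ : [set w | _] = D 0%N @^-1` returning mu) ?lawN//.
  by apply/seteqP; split=> w /isSome_passE.
have indep := passes_independent draws.
have hit B q : measurable B -> B `<=` returning mu ->
    (forall n, Pr (D n @^-1` B) = q%:E) ->
    Pr (first_hit_in D (returning mu) B) = (q / p)%:E.
  by move=> mB BN PB; exact: (probability_first_hit_in mD mN mB BN indep p0 lawN PB).
have mhit B : measurable B -> measurable (first_hit_in D (returning mu) B).
  by move=> mB; exact: measurable_first_hit_in.
rewrite rp; split => //.
- rewrite (_ : [set w | _] = first_hit_in D (returning mu) (returning mu)).
    by rewrite (hit _ p)// divff// gt_eqF.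
  by apply/seteqP; split=> w /isSome_loopE.
- move=> n A mA.
  have mB1 := measurable_returns_in1 mu mA.
  have mBN1 := measurable_returns_inN1 mu mA.
  under eq_fun do rewrite weighted_countE.
  rewrite (expectation_indicB Pr (mpre n _ mB1) (mpre n _ mBN1)).
  by rewrite law1// lawN1// -EFinB acceptedB.
- move=> A mA.
  have mB1 := measurable_returns_in1 mu mA.
  have mBN1 := measurable_returns_inN1 mu mA.
  under eq_fun do rewrite weighted_count_loopE.
  rewrite (expectation_indicB Pr (mhit _ mB1) (mhit _ mBN1)).
  rewrite (hit _ _ mB1 _ (fun n => law1 n A mA)); last exact: returns_in_returning1.
  rewrite (hit _ _ mBN1 _ (fun n => lawN1 n A mA)); last exact: returns_in_returningN1.
  (* Both weights carry the same factor [p^-1], so the difference is the one-pass density divided by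
     [p]. *)
  by rewrite -EFinB -mulrBl acceptedB// mulrC.
Qed.
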